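(* Let $\tau=(n_i)_{i\in I}$, $n_i>0$ for all $i\in I$, be any type. For each $\sigma\in Hyp(\tau)$ the following statements are equivalent: (i) $\sigma\in Bij(\tau)$, i.e. $\widehat{\sigma}:W_\tau(X)\to W_\tau(X)$ is a bijection. (ii) There are $h\in\mathcal{B}$ and $p\in\mathcal{P}$ such that $\sigma(f_i)=h(f_i)(x_{p(i)(1)},\ldots,x_{p(i)(n_i)})$ for all $i\in I$.
   Context: Let $\Omega=\{f_i\mid i\in I\}$ be a set of operation symbols, where $f_i$ is $n_i$-ary. $W_\tau(X)$ is the set of all terms of type $\tau$ over the alphabet $X=\{x_1,x_2,\ldots\}$; terms in $W_\tau(X_n)$, with $X_n=\{x_1,\ldots,x_n\}$, $n\ge 1$, are called $n$-ary. For an $n$-ary term $t$ and terms $t_1,\ldots,t_n$, $S^n(t,t_1,\ldots,t_n)$ denotes the term obtained from $t$ by simultaneously substituting $t_k$ for $x_k$, $1\le k\le n$. A hypersubstitution of type $\tau$ is a mapping $\sigma:\Omega\to W_\tau(X)$ assigning to every $n_i$-ary operation symbol $f_i$ an $n_i$-ary term $\sigma(f_i)\in W_\tau(X_{n_i})$. $Hyp(\tau)$ is the set of all of them. Each $\sigma\in Hyp(\tau)$ induces $\widehat{\sigma}:W_\tau(X)\to W_\tau(X)$ by $\widehat{\sigma}[w]:=w$ for $w\in X$ and $\widehat{\sigma}[f_i(t_1,\ldots,t_{n_i})]:=S^{n_i}(\sigma(f_i),\widehat{\sigma}[t_1],\ldots,\widehat{\sigma}[t_{n_i}])$. $Bij(\tau)$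 is the set of all $\sigma\in Hyp(\tau)$ such that $\widehat{\sigma}$ is a bijection on $W_\tau(X)$. $\mathcal{B}$ is the set of all bijections $\Omega\to\Omega$ preserving the arity. $S_n$ is the set of all permutations of $\{1,\ldots,n\}$ for $n\ge 1$, $A:=\bigcup_{n\ge 1}S_n$, and $\mathcal{P}:=\{p\in A^I\mid p(i)\in S_{n_i}\text{ for all } i\in I\}$. *)

(* Defs.v *)
From mathcomp Require Import all_boot all_fingroup.

Set Implicit Arguments.
Unset Strict Implicit.
Unset Printing Implicit Defensive.

(* A type [tau] is a family of arities indexed by [I]; the operation symbol
   f_i is identified with its index [i], so that Omega is [I] itself.
   The variables x_1, x_2, ... are numbered from 0: x_(k+1) is [Var k]. *)
Inductive term (I : Type) (tau : I -> nat) : Type :=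
| Var of nat
| App (i : I) of {ffun 'I_(tau i) -> term tau}.

Arguments Var {I tau} _.
Arguments App {I tau} i _.

Section Hypersubstitutions.

Variables (I : Type) (tau : I -> nat).
Implicit Types t : term tau.

(* [is_nary m t]: [t] belongs to W_tau(X_m). *)
Fixpoint is_nary (m : nat) t : bool :=
  match t with
  | Var k => k < m
  | App i a => [forall j : 'I_(tau i), is_nary m (a j)]
  end.

(* [Ssubst t s] is S^m(t, t_1, ..., t_m), where t_(k+1) is [s k]. It is only
   meant for [t] m-ary; variables outside X_m are left unchanged. *)
Fixpoint Ssubst (m : nat) t (s : 'I_m -> term tau) : term tau :=
  match t with
  | Var k => if insub k is Some j then s j else Var k
  | App i a => App i [ffun j => Ssubst (a j) s]
  end.

Record hypersubstitution := Hypersubstitution {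
  hyp_fun :> I -> term tau;
  hyp_nary : forall i, is_nary (tau i) (hyp_fun i)
}.

Fixpoint hyp_ext (sigma : hypersubstitution) t : term tau :=
  match t with
  | Var k => Var k
  | App i a => Ssubst (sigma i) (fun j => hyp_ext sigma (a j))
  end.

Definition Bij (sigma : hypersubstitution) : Prop := bijective (hyp_ext sigma).

Record arity_bijection := ArityBijection {
  ab_fun :> I -> I;
  ab_bij : bijective ab_fun;
  ab_arity : forall i, tau (ab_fun i) = tau i
}.

(* The term h(f_i)(x_(q(1)), ..., x_(q(n_i))); the cast is needed because the
   arguments of h(f_i) are indexed by its own arity [tau (h i)]. *)
Definition permuted_app (h : arity_bijection) (i : I) (q : 'S_(tau i)) :
    term tau :=
  App (h i) [ffun j => Var (q (cast_ord (ab_arity h i) j))].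

End Hypersubstitutions.

(* Main.v *)
(** The extension of [sigma] fixes every variable, so when it is injective no
    [sigma i] is a variable and no composed term is sent to a variable.  A
    preimage of [f_j(x_1, ..., x_n)] is therefore some [f_i(a)] such that
    [sigma i] is [f_j] applied to variables; injectivity makes these variables
    pairwise distinct and exhaust [x_1, ..., x_(n_i)].  Finally, [sigma i] and
    [sigma i'] cannot have the same head [f_j]: if [sigma i'] permutes variables
    under [f_j], then by surjectivity its extension reaches every term with
    head [f_j], in particular the image of any term with head [f_i]. *)
Require Import Defs.
From mathcomp Require Import all_boot all_fingroup.
From Stdlib Require Import Eqdep ClassicalEpsilon.

Set Implicit Arguments.
Unset Strict Implicit.
Unset Printing Implicit Defensive.

(** [bijective] asks for an inverse function, so a preimage of each point is picked by classical
    choice. *)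
Lemma inj_surj_bij (A B : Type) (f : A -> B) :
  injective f -> (forall y, exists x, f x = y) -> bijective f.
Proof.
move=> f_inj f_surj.
pose g y := proj1_sig (constructive_indefinite_description _ (f_surj y)).
have gK y : f (g y) = y by rewrite /g; case: constructive_indefinite_description.
by exists g => // x; apply: f_inj.
Qed.

Section BijectiveHypersubstitutions.

Variables (I : Type) (tau : I -> nat).
Implicit Types (t : term tau) (sigma : hypersubstitution tau).

(* The generated [term_ind] has no induction hypothesis for the arguments
   of [App], which occur nested inside a finite function. *)
Lemma term_nested_ind (P : term tau -> Prop) :
  (forall k, P (Var k)) ->
  (forall i (a : {ffun 'I_(tau i) -> term tau}),
     (forall j, P (a j)) -> P (App i a)) ->
  forall t, P t.
Proof.
move=> PVar PApp; fix IH 1 => -[k | i a]; first exact: PVar.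
by apply: PApp => j; apply: IH.
Qed.

Lemma App_head i j (a : {ffun 'I_(tau i) -> term tau})
    (b : {ffun 'I_(tau j) -> term tau}) :
  App i a = App j b -> i = j.
Proof. by case. Qed.

(** Equality on [I] need not be decidable, so cancelling the dependent pair relies on the axiom
    behind [inj_pair2]. *)
Lemma App_inj i : injective (@App I tau i).
Proof. by move=> a b [eq_ab]; apply: inj_pair2 eq_ab. Qed.

Lemma hyp_ext_App_Var sigma i j (q : 'I_(tau j) -> 'I_(tau i))
    (a : {ffun 'I_(tau i) -> term tau}) :
  sigma i = App j [ffun l => Var (q l)] ->
  hyp_ext sigma (App i a) = App j [ffun l => hyp_ext sigma (a (q l))].
Proof.
move=> /= ->; congr (App j _); apply/ffunP => l.
by rewrite !ffunE /= valK.
Qed.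

Lemma hyp_ext_Var_preim sigma t k :
  injective (hyp_ext sigma) -> hyp_ext sigma t = Var k -> t = Var k.
Proof. by move=> sI tk; apply: sI. Qed.

(** Being [tau i]-ary, a variable [sigma i] would act as a projection, sending f_i(x_1, ..., x_1) to
    x_1, which is already its own image. *)
Lemma hyp_neq_Var sigma i k :
  injective (hyp_ext sigma) -> sigma i <> Var k.
Proof.
move=> sI si; have k_lt : k < tau i by have := hyp_nary sigma i; rewrite si.
have // : App i [ffun=> Var 0] = Var 0 :> term tau.
by apply: (hyp_ext_Var_preim sI); rewrite /= si /= insubT ffunE.
Qed.

Lemma hyp_preim_App_Var sigma j : Bij sigma ->
  exists i (q : 'I_(tau j) -> 'I_(tau i)),
    bijective q /\ sigma i = App j [ffun l => Var (q l)].
Proof.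
move=> sB; have sI := bij_inj sB; have [g _ gK] := sB.
have := gK (App j [ffun l : 'I_(tau j) => Var l]).
case: (g _) => [//|i a]; rewrite /=; have := hyp_nary sigma i.
case si: (sigma i) => [k|j' b] /=; first by case: (hyp_neq_Var sI si).
move=> /forallP b_nary eq_app; have ej := App_head eq_app.
move: ej b b_nary si eq_app => -> b b_nary si /App_inj/ffunP eq_b.
(* Substitution turns [b l] into [Var l], so [b l] is itself some [Var k]; then [a k] has image
   [Var l], whose only preimage is [Var l]. *)
have /fin_all_exists [q qP] (l : 'I_(tau j)) :
    exists k : 'I_(tau i), b l = Var k /\ a k = Var l.
  have := eq_b l; have := b_nary l; rewrite !ffunE.
  case: (b l) => [k /= k_lt|//]; rewrite insubT => al.
  by exists (Ordinal k_lt); split=> //; apply: hyp_ext_Var_preim sI al.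
have si' : sigma i = App j [ffun l => Var (q l)].
  by rewrite si; congr (App j _); apply/ffunP => l; rewrite ffunE; case: (qP l).
exists i, q; split=> //.
have q_inj : injective q.
  move=> l l' eq_q; have [_ al] := qP l; have [_] := qP l'.
  by rewrite -eq_q al => -[/val_inj].
apply: inj_surj_bij => // k; case: (boolP (k \in codom q)) => [/codomP[l ->]|kNq].
  by exists l.
(* If [q] missed [k], argument [k] would be ignored; [c true] and [c false] differ only there, with
   values [Var 1] and [Var 0]. *)
pose c b k' : term tau := Var (b && (k' == k)).
have /sI/App_inj/ffunP/(_ k) : hyp_ext sigma (App i (finfun (c true))) =
                               hyp_ext sigma (App i (finfun (c false))).
  rewrite !(hyp_ext_App_Var _ si'); congr (App j _); apply/ffunP => l.
  rewrite !ffunE /c; case: eqP => // eq_k.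
  by rewrite -eq_k codom_f in kNq.
by rewrite !ffunE /c eqxx.
Qed.

Lemma hyp_head_inj sigma i i' j (b : {ffun 'I_(tau j) -> term tau})
    (q : 'I_(tau j) -> 'I_(tau i')) :
  Bij sigma -> bijective q -> sigma i = App j b ->
  sigma i' = App j [ffun l => Var (q l)] -> i = i'.
Proof.
move=> [g sK gK] [q' qK _] si si'.
have : exists c, hyp_ext sigma (App i [ffun=> Var 0]) = App j c.
  by rewrite /= si /=; eexists.
(* A second preimage, with head [i']: [g] pulls the arguments in [c] back, and [q'] puts each where
   [q] reads it. *)
case=> c sc; have : hyp_ext sigma (App i' [ffun k => g (c (q' k))]) = App j c.
  rewrite (hyp_ext_App_Var _ si'); congr (App j _); apply/ffunP => l.
  by rewrite !ffunE qK gK.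
by rewrite -sc => /(can_inj sK)/esym/App_head.
Qed.

Lemma hyp_App_Var sigma i : Bij sigma ->
  exists j (q : 'I_(tau j) -> 'I_(tau i)),
    bijective q /\ sigma i = App j [ffun l => Var (q l)].
Proof.
move=> sB; case si: (sigma i) => [k|j b].
  by case: (hyp_neq_Var (bij_inj sB) si).
have [i' [q [q_bij si']]] := hyp_preim_App_Var j sB.
have ei := hyp_head_inj sB q_bij si si'.
by move: ei q q_bij si si' => <- q q_bij si si'; exists j, q; rewrite -si.
Qed.

Lemma Bij_permuted_app sigma : Bij sigma ->
  exists (h : arity_bijection tau) (p : forall i, 'S_(tau i)),
    forall i, sigma i = permuted_app h (p i).
Proof.
move=> sB.
pose hS i := constructive_indefinite_description _ (hyp_App_Var i sB).
pose h i := proj1_sig (hS i).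
pose qS i := constructive_indefinite_description _ (proj2_sig (hS i)).
pose q i : 'I_(tau (h i)) -> 'I_(tau i) := proj1_sig (qS i).
have q_bij i : bijective (q i) := proj1 (proj2_sig (qS i)).
have sE i : sigma i = App (h i) [ffun l => Var (q i l)] :=
  proj2 (proj2_sig (qS i)).
have h_ar i : tau (h i) = tau i.
  by have := bij_eq_card (q_bij i); rewrite !card_ord.
have h_bij : bijective h.
  apply: inj_surj_bij => [i i' eq_h | j].
    move: (q i') (q_bij i') (sE i'); rewrite -eq_h => q' q'_bij si'.
    exact: hyp_head_inj sB q'_bij (sE i) si'.
  have [i [q' [_ si]]] := hyp_preim_App_Var j sB.
  by exists i; move: si; rewrite sE => /App_head.
(* The cast makes [q i] a self-map of ['I_(tau i)], so that injectivity yields a permutation. *)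
have p_inj i : injective (q i \o cast_ord (esym (h_ar i))).
  by apply: inj_comp; [exact: bij_inj | exact: cast_ord_inj].
exists (ArityBijection h_bij h_ar), (fun i => perm (@p_inj i)) => i.
rewrite sE /permuted_app /=; congr (App _ _); apply/ffunP => l.
by rewrite !ffunE permE /= cast_ordK.
Qed.

Section PermutedApp.

Variables (sigma : hypersubstitution tau) (h : arity_bijection tau).
Variable p : forall i, 'S_(tau i).
Hypothesis sigmaE : forall i, sigma i = permuted_app h (p i).

Let hyp_extE i (a : {ffun 'I_(tau i) -> term tau}) :
  hyp_ext sigma (App i a) =
  App (h i) [ffun l => hyp_ext sigma (a (p i (cast_ord (ab_arity h i) l)))].
Proof. exact: hyp_ext_App_Var (sigmaE i). Qed.

Lemma permuted_app_inj : injective (hyp_ext sigma).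
Proof.
elim/term_nested_ind=> [k|i a IH] [k'|i' a'] //; rewrite !hyp_extE // => eq_a.
have ei := bij_inj (ab_bij h) (App_head eq_a).
move: ei a' eq_a => <- a' /App_inj/ffunP eq_a; congr (App i _); apply/ffunP => k.
(* Up to the cast, argument [k] lands at position [(p i)^-1 k] of the image. *)
apply: IH; have := eq_a (cast_ord (esym (ab_arity h i)) ((p i)^-1%g k)).
by rewrite !ffunE cast_ordKV permKV.
Qed.

Lemma permuted_app_surj t : exists t', hyp_ext sigma t' = t.
Proof.
elim/term_nested_ind: t => [k|j b]; first by exists (Var k).
(* Once [j] is written as [h i], the preimage has head [i], with preimages of the arguments
   reordered by the inverse of [p i]. *)
have [h' _ h'K] := ab_bij h; rewrite -(h'K j) in b *; set i := h' j in b *.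
move=> /fin_all_exists[c cE].
exists (App i [ffun k => c (cast_ord (esym (ab_arity h i)) ((p i)^-1%g k))]).
rewrite hyp_extE; congr (App _ _); apply/ffunP => l.
by rewrite !ffunE permK cast_ordK.
Qed.

Lemma permuted_app_Bij : Bij sigma.
Proof. exact: inj_surj_bij permuted_app_inj permuted_app_surj. Qed.

End PermutedApp.

End BijectiveHypersubstitutions.

Theorem theorem1 (I : Type) (tau : I -> nat) (tau_gt0 : forall i : I, 0 < tau i)
    (sigma : hypersubstitution tau) :
  Bij sigma <->
  exists (h : arity_bijection tau) (p : forall i : I, 'S_(tau i)),
    forall i : I, sigma i = permuted_app h (p i).
Proof.
split=> [|[h [p sigmaE]]]; first exact: Bij_permuted_app.
exact: permuted_app_Bij sigmaE.
Qed.
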